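(* Let $v\geq 2$, $n\geq 1$ and $0\leq\Delta<v$ be integers. Then for every integer $L\geq 0$, \[ G\!\left(L-\Delta 2^{n-1},\,L+\Delta 2^{n-1},\,(v+\Delta)\Big(2\tfrac{2^n-2^{-n}}{3}+\tfrac{1}{2^nv}\Big),\,(v-\Delta)\Big(2\tfrac{2^n-2^{-n}}{3}+\tfrac{1}{2^nv}\Big),\,2^nv,\,q\right)\geq 0, \] i.e. this polynomial in $q$ has nonnegative coefficients.
   Context: For integers $n\ge0$, $(q)_n=\prod_{j=1}^{n}(1-q^j)$; for integers $m,n$, ${n+m \brack n}_q=\frac{(q)_{n+m}}{(q)_n(q)_m}$ if $m,n\geq 0$ and $0$ otherwise. For integers $N,M$, real $\alpha,\beta$ and positive integer $K$ (with the exponents below integers), $G(N,M,\alpha,\beta,K,q)=\sum_{j=-\infty}^{\infty}(-1)^jq^{Kj\frac{(\alpha+\beta)j+(\alpha-\beta)}{2}}{N+M \brack N-Kj}_q$. For a polynomial $P(q)$, $P(q)\geq 0$ means all its coefficients are nonnegative. *)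

(* Defs.v *)
From mathcomp Require Import all_boot all_order all_algebra.
From mathcomp Require Import boolp classical_sets cardinality fsbigop reals.
From mathcomp Require Import ring lra zify.

Set Implicit Arguments.
Unset Strict Implicit.
Unset Printing Implicit Defensive.

Import Order.TTheory GRing.Theory Num.Theory.
Local Open Scope classical_set_scope.
Local Open Scope ring_scope.

(* Everything lives in the field Q(q) = Frac Z[q], so that quotients of
   q-factorials and integer powers of q have their literal meaning. *)
Notation ratfun := {fraction {poly int}}.

Definition poly_ratfun (P : {poly int}) : ratfun := FracField.tofrac P.

Definition q : ratfun := poly_ratfun 'X.

Definition qfact (n : nat) : ratfun := \prod_(1 <= j < n.+1) (1 - q ^+ j).

(* [qbinom a b] is the bracket with top a and bottom b: with b = n and
   a = n + m, it is (q)_(n+m) / ((q)_n (q)_m) if m, n >= 0, and 0 otherwise. *)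
Definition qbinom (a b : int) : ratfun :=
  if (0 <= b) && (0 <= a - b)
  then qfact `|a|%N / (qfact `|b|%N * qfact `|a - b|%N) else 0.

Definition Gexp (R : realType) (alpha beta : R) (K : nat) (j : int) : R :=
  K%:R * j%:~R * (((alpha + beta) * j%:~R + (alpha - beta)) / 2).

(* [Num.floor] only serves to read the real number [Gexp] as an integer; G is
   meaningful when all the [Gexp] are integers, see [Gexp_int] below. *)
Definition Gterm (R : realType) (N M : int) (alpha beta : R) (K : nat)
    (j : int) : ratfun :=
  (-1) ^ j * q ^ Num.floor (Gexp alpha beta K j) * qbinom (N + M) (N - K%:Z * j).

(* A sum over all of Z; it has finite support for K > 0, see
   [Gterm_finite_support] below. *)
Definition G (R : realType) (N M : int) (alpha beta : R) (K : nat) : ratfun :=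
  \sum_(j \in [set: int]) Gterm N M alpha beta K j.

Definition nonneg_coefs (f : ratfun) : Prop :=
  exists2 P : {poly int}, f = poly_ratfun P & forall i : nat, 0 <= P`_i.

Lemma Gterm_finite_support (R : realType) (N M : int) (alpha beta : R)
    (K : nat) : (0 < K)%N ->
  finite_set ([set: int] `&` Gterm N M alpha beta K @^-1` [set~ 0]).
Proof.
move=> K0; pose B := (`|N| + `|M|)%N.
apply: (@sub_finite_set _ _ [set` [seq k%:Z - B%:Z | k <- iota 0 (B + B).+1]]).
  move=> j [_]; rewrite /preimage /mkset /Gterm /qbinom.
  case: ifP => [/andP[h1 h2] _|_]; last by rewrite mulr0 => /(_ erefl).
  have jN : - B%:Z <= j <= B%:Z by rewrite /B; nia.
  by apply/mapP; exists `|(j + B%:Z)%R|%N; [rewrite mem_iota|]; lia.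
exact: finite_seq.
Qed.

Lemma Gexp_int (R : realType) (v n Delta : nat) (j : int) :
  (2 <= v)%N -> (Delta < v)%N ->
  let c : R := 2 * ((2 ^+ n - 2 ^- n) / 3) + 1 / (2 ^+ n * v%:R) in
  exists2 e : nat,
    Gexp ((v%:R + Delta%:R) * c) ((v%:R - Delta%:R) * c) (2 ^ n * v) j = e%:R
    & e%:Z = (2 * v * ((4 ^ n - 1) %/ 3) + 1)%:Z * (j * (v%:Z * j + Delta%:Z)).
Proof.
move=> v2 Dv c.
have [t tE] : exists t, (4 ^ n = 3 * t + 1)%N.
  elim: n {c} => [|n [t tE]]; first by exists 0%N.
  by exists (4 * t + 1)%N; rewrite expnS; lia.
have tD : ((4 ^ n - 1) %/ 3 = t)%N by rewrite tE addnK mulKn.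
have e0 : 0 <= j * (v%:Z * j + Delta%:Z).
  have [j0|j0] := lerP 0 j; first by nia.
  by apply: mulr_le0; [lia|nia].
exists ((2 * v * t + 1) * `|(j * (v%:Z * j + Delta%:Z))%R|)%N; last first.
  by rewrite tD PoszM gez0_abs.
rewrite natrM natr_absz (ger0_norm e0).
have x0 : (2 : R) ^+ n != 0 by rewrite expf_neq0 // pnatr_eq0.
have v0 : (v%:R : R) != 0 by rewrite pnatr_eq0; lia.
have tR : ((2 : R) ^+ n) ^+ 2 = 3 * t%:R + 1.
  by rewrite -exprM mulnC exprM -natrX -natrX tE natrD natrM.
have tR' : t%:R = (((2 : R) ^+ n) ^+ 2 - 1) / 3 by rewrite tR; field.
rewrite /Gexp /c !natrM !natrD !natrM natrX tR' !rmorphM !rmorphD !rmorphM /=.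
rewrite -!pmulrn; field.
by rewrite x0 v0.
Qed.

(* Main.v *)
Require Import Defs.
From mathcomp Require Import all_boot all_order all_algebra.
From mathcomp Require Import boolp classical_sets cardinality fsbigop reals.
From mathcomp Require Import ring zify.
Import Order.TTheory GRing.Theory Num.Theory.
Local Open Scope ring_scope.

(* Put [a_j = 2 v j + Delta].  Up to a power of q that does not depend on j, the
   j-th term of G is [(-1)^j q^(a_j^2 (1/(4v) + t/2)) [2L; L - 2^(n-1) a_j]] with
   [t = (4^n - 1) / 3].  Two applications of the q-Vandermonde sum give
     [q^(A^2/2) [2L; L - A] =
        sum over i, M with M = A mod 2 of
          q^((i^2 + (i-M)^2)/2) [L; i] [i; M] [M; (M-A)/2]],
   whose coefficients are positive and do not depend on A.  With [A = 2^n a_j]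
   it expresses the sum for n + 1 as a positive combination of sums for n, which
   leaves the case n = 0.  Grouping there the even and the odd j gives a
   generating function of partitions with prescribed hook differences in the
   sense of Andrews, Baxter, Bressoud, Burge, Forrester and Viennot, with
   alpha = beta = 1; its positivity follows from the q-Pascal rules, which close
   on the three cases (alpha, beta) = (1,1), (0,2), (2,0). *)

(** * Closure properties of nonnegative coefficients *)

Lemma nonneg_coefs0 : nonneg_coefs 0.
Proof. by exists 0 => [|i]; rewrite ?coef0 // /poly_ratfun rmorph0. Qed.

Lemma nonneg_coefs1 : nonneg_coefs 1.
Proof.
by exists 1 => [|i]; rewrite ?coef1 ?ler0n // /poly_ratfun rmorph1.
Qed.

Lemma nonneg_coefsD f g :
  nonneg_coefs f -> nonneg_coefs g -> nonneg_coefs (f + g).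
Proof.
move=> [P -> P0] [Q -> Q0]; exists (P + Q) => [|i]; last by rewrite coefD addr_ge0.
by rewrite /poly_ratfun rmorphD.
Qed.

Lemma nonneg_coefsM f g :
  nonneg_coefs f -> nonneg_coefs g -> nonneg_coefs (f * g).
Proof.
move=> [P -> P0] [Q -> Q0]; exists (P * Q) => [|i].
  by rewrite /poly_ratfun rmorphM.
by rewrite coefM sumr_ge0 // => j _; rewrite mulr_ge0.
Qed.

Lemma nonneg_coefs_qX (z : int) : 0 <= z -> nonneg_coefs (q ^ z).
Proof.
case: z => // k _; exists 'X^k => [|i]; last by rewrite coefXn ler0n.
by rewrite /poly_ratfun rmorphXn.
Qed.

Lemma nonneg_coefs_sum (I : Type) (r : seq I) (F : I -> ratfun) :
  (forall i, nonneg_coefs (F i)) -> nonneg_coefs (\sum_(i <- r) F i).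
Proof.
by move=> F0; apply: big_ind => //; [exact: nonneg_coefs0|exact: nonneg_coefsD].
Qed.

(** * q-factorials, the q-Pascal rules and positivity of q-binomials *)

Lemma q_neq0 : q != 0.
Proof. by rewrite tofrac_eq0 polyX_eq0. Qed.

Lemma onem_qX_neq0 j : 1 - q ^+ j.+1 != 0.
Proof.
rewrite subr_eq0 eq_sym /q /poly_ratfun -tofracXn -tofrac1 tofrac_eq.
apply/eqP => /(congr1 (fun P : {poly int} => size P)).
by rewrite size_polyXn size_poly1.
Qed.

Lemma qfactS n : qfact n.+1 = qfact n * (1 - q ^+ n.+1).
Proof. by rewrite /qfact big_nat_recr. Qed.

Lemma qfact_neq0 n : qfact n != 0.
Proof.
elim: n => [|n IH]; first by rewrite /qfact big_geq // oner_neq0.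
by rewrite qfactS; apply: mulf_neq0 IH (onem_qX_neq0 n).
Qed.

Lemma qbinom_out (a b : int) : b < 0 \/ a < b -> qbinom a b = 0.
Proof. by move=> h; rewrite /qbinom ifF //; lia. Qed.

Lemma qbinomE m n : qbinom (m + n)%:Z m%:Z = qfact (m + n) / (qfact m * qfact n).
Proof.
rewrite /qbinom ifT; last by lia.
by rewrite (_ : (m + n)%:Z - m%:Z = n%:Z); [rewrite !absz_nat|lia].
Qed.

Lemma qbinom_sym (a b : int) : qbinom a (a - b) = qbinom a b.
Proof.
rewrite /qbinom (_ : a - (a - b) = b); last by lia.
by rewrite andbC (mulrC (qfact `|a - b|)).
Qed.

Lemma qbinomn0 (a : int) : 0 <= a -> qbinom a 0 = 1.
Proof.
case: a => // n _; rewrite -[n in Posz n]add0n qbinomE add0n.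
by rewrite {2}/qfact big_geq // mul1r divff // qfact_neq0.
Qed.

Lemma qbinomnn (a : int) : 0 <= a -> qbinom a a = 1.
Proof. by move=> a0; rewrite -[X in qbinom _ X]subr0 qbinom_sym qbinomn0. Qed.

(** Amounts to [1 - x y = (1 - x) + x (1 - y)]; [x] and [y] will be the last powers of [q] in the
    two factorials of the denominator. *)
Lemma pascal_field (F : fieldType) (f m n x y : F) :
  m != 0 -> n != 0 -> 1 - x != 0 -> 1 - y != 0 ->
  f * (1 - x * y) / (m * (1 - x) * (n * (1 - y))) =
  f / (m * (n * (1 - y))) + x * (f / (m * (1 - x) * n)).
Proof. by move=> m0 n0 x0 y0; field; rewrite m0 n0 x0 y0. Qed.

(** The bottom [b] is any integer, so sums over Z can be treated termwise; positivity of [a] rules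
    out [a = b = 0], where the sides are 1 and 0. *)
Lemma qbinom_pascal (a b : int) : 0 < a ->
  qbinom a b = qbinom (a - 1) (b - 1) + q ^ b * qbinom (a - 1) b.
Proof.
move=> a0; have [b0|b0] := lerP b 0; last have [ab|ab] := lerP a b.
- have [->|b1] := eqVneq b 0.
    by rewrite expr0z mul1r (@qbinom_out _ (0 - 1)) ?add0r ?qbinomn0 //; lia.
  by rewrite !qbinom_out ?mulr0 ?addr0 //; lia.
- have [->|b1] := eqVneq a b.
    by rewrite (@qbinom_out (b - 1) b) ?mulr0 ?addr0 ?qbinomnn //; lia.
  by rewrite !qbinom_out ?mulr0 ?addr0 //; lia.
have [m bE] : exists m : nat, b = m.+1%:Z by exists `|b|.-1; lia.
have [n aE] : exists n : nat, a = (m.+1 + n.+1)%:Z by exists `|a - b|.-1; lia.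
rewrite {}aE {}bE qbinomE.
rewrite [X in qbinom X](_ : _ = (m + n.+1)%:Z); last by lia.
rewrite [X in qbinom _ X + _](_ : _ = m%:Z); last by lia.
rewrite qbinomE [X in qbinom X](_ : _ = (m.+1 + n)%:Z); last by lia.
rewrite qbinomE !addSn !addnS (qfactS (m + n).+1) (qfactS m) (qfactS n).
rewrite -exprnP -addSn -addnS exprD.
by apply: pascal_field; rewrite ?qfact_neq0 ?onem_qX_neq0.
Qed.

Lemma qbinom_pascal_sym (a b : int) : 0 < a ->
  qbinom a b = qbinom (a - 1) b + q ^ (a - b) * qbinom (a - 1) (b - 1).
Proof.
move=> a0; rewrite -qbinom_sym qbinom_pascal //.
rewrite -[in LHS](qbinom_sym (a - 1)) -[X in _ + _ * X = _](qbinom_sym (a - 1)).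
by congr (qbinom _ _ + _ * qbinom _ _); lia.
Qed.

Lemma nonneg_coefs_qbinom (a b : int) : nonneg_coefs (qbinom a b).
Proof.
case: a => [n|n]; last by rewrite qbinom_out; [exact: nonneg_coefs0|lia].
elim: n b => [|n IH] b.
  have [->|b0] := eqVneq b 0; first by rewrite qbinomnn //; exact: nonneg_coefs1.
  by rewrite qbinom_out; [exact: nonneg_coefs0|lia].
have [b0|b0] := lerP 0 b; last first.
  by rewrite qbinom_out; [exact: nonneg_coefs0|lia].
rewrite qbinom_pascal // (_ : n.+1%:Z - 1 = n) ; last by lia.
by apply: nonneg_coefsD => //; apply: nonneg_coefsM => //; exact: nonneg_coefs_qX.
Qed.

(** * Finitely supported sums over the integers *)

(** A sum over Z with infinite support has the default value 0, so additivity requires finite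
    support. An explicit radius lets two families share one window. *)
Definition finsupp (f : int -> ratfun) :=
  exists B : nat, forall j : int, (B < `|j|)%N -> f j = 0.

Lemma finsupp_win (f : int -> ratfun) (B : nat) :
  (forall j : int, (B < `|j|)%N -> f j = 0) ->
  \sum_(j \in [set: int]%classic) f j =
  \sum_(j <- [seq k%:Z - B%:Z | k <- iota 0 (B + B).+1]) f j.
Proof.
move=> fB; rewrite (fsbigE [seq k%:Z - B%:Z | k <- iota 0 (B + B).+1]).
- by apply: eq_bigl => j; rewrite in_setT.
- by rewrite map_inj_uniq ?iota_uniq // => i j; lia.
- by [].
move=> j _ /negP jw; apply: fB; rewrite ltnNge; apply/negP => jB; apply: jw.
by apply/mapP; exists `|(j + B%:Z)%R|%N; [rewrite mem_iota|]; lia.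
Qed.

Lemma sumZD f g : finsupp f -> finsupp g ->
  \sum_(j \in [set: int]%classic) (f j + g j) =
  \sum_(j \in [set: int]%classic) f j + \sum_(j \in [set: int]%classic) g j.
Proof.
move=> [B fB] [C gC].
have fM j : (B + C < `|j|)%N -> f j = 0 by move=> h; apply: fB; lia.
have gM j : (B + C < `|j|)%N -> g j = 0 by move=> h; apply: gC; lia.
rewrite !(@finsupp_win _ (B + C)) ?big_split // => j h.
by rewrite fM ?gM ?addr0.
Qed.

Lemma finsuppD f g : finsupp f -> finsupp g -> finsupp (fun j => f j + g j).
Proof.
move=> [B fB] [C gC]; exists (B + C)%N => j h.
by rewrite fB ?gC ?addr0 //; lia.
Qed.

Lemma finsuppM f g : finsupp g -> finsupp (fun j => f j * g j).
Proof. by move=> [B gB]; exists B => j /gB ->; rewrite mulr0. Qed.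

Lemma finsupp_sum (I : Type) (r : seq I) (F : I -> int -> ratfun) :
  (forall i, finsupp (F i)) -> finsupp (fun j => \sum_(i <- r) F i j).
Proof.
move=> FF; elim: r => [|i r [B IH]]; first by exists 0%N => j _; rewrite big_nil.
have [C FC] := FF i; exists (B + C)%N => j h.
by rewrite big_cons FC ?IH ?addr0 //; lia.
Qed.

Lemma sumZ_sum (I : Type) (r : seq I) (F : I -> int -> ratfun) :
  (forall i, finsupp (F i)) ->
  \sum_(j \in [set: int]%classic) \sum_(i <- r) F i j =
  \sum_(i <- r) \sum_(j \in [set: int]%classic) F i j.
Proof.
move=> FF; elim: r => [|i r IH].
  by rewrite big_nil fsbig1 // => j _; rewrite big_nil.
rewrite big_cons -IH -sumZD //; last exact: finsupp_sum.
by apply: eq_fsbigr => j _; rewrite big_cons.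
Qed.

Lemma finsupp_qbinom (a c K : int) : 0 < K ->
  finsupp (fun j => qbinom a (c - K * j)).
Proof.
move=> K0; exists (`|a| + `|c|)%N => j jB; apply: qbinom_out.
have [j0|j0] := lerP 0 j; [left|right]; nia.
Qed.

(** Odd indices are written [1 - 2 m] so that, after complementing the bottom of the bracket, they
    line up with the negative part of [hookterm]. *)
Lemma sumZ_even_odd (h : int -> ratfun) : finsupp h ->
  \sum_(j \in [set: int]%classic) h j =
  \sum_(m \in [set: int]%classic) (h (2 * m) + h (1 - 2 * m)).
Proof.
move=> [B hB].
pose u j := if (2 %| j)%Z then h j else 0; pose w j := if (2 %| j)%Z then 0 else h j.
have uB : finsupp u by exists B => j /hB; rewrite /u => ->; case: ifP.
have wB : finsupp w by exists B => j /hB; rewrite /w => ->; case: ifP.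
have -> : \sum_(j \in [set: int]%classic) h j =
    \sum_(j \in [set: int]%classic) (u j + w j).
  by apply: eq_fsbigr => j _; rewrite /u /w; case: ifP; rewrite ?addr0 ?add0r.
rewrite sumZD // sumZD; first last.
- by exists B => j jB; apply: hB; lia.
- by exists B => j jB; apply: hB; lia.
congr (_ + _).
- rewrite -(@fsbig_widen _ _ _ _ (range (fun m : int => 2 * m))) //; last first.
    move=> j [_ nj] /=; rewrite /u; case: ifP => // /dvdzP [m jE]; case: nj.
    by exists m => //; rewrite jE mulrC.
  rewrite fsbig_image; last by move=> x y _ _; lia.
  by apply: eq_fsbigr => m _; rewrite /u dvdz_mulr.
- rewrite -(@fsbig_widen _ _ _ _ (range (fun m : int => 1 - 2 * m))) //; last first.
    move=> j [_ nj] /=; rewrite /w; case: ifP => // /negbT jo; case: nj.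
    have /eqP j1 : (1 - (j %% 2)%Z) == 0 by lia.
    by exists (- (j %/ 2)%Z) => //; lia.
  rewrite fsbig_image; last by move=> x y _ _; lia.
  by apply: eq_fsbigr => m _; rewrite /w ifF //; lia.
Qed.

(** * Hook difference polynomials: recurrences, boundary values, positivity *)

(* [hookpoly K i b N M] is the polynomial D_(K,i)(N, M; alpha, beta) of
   Andrews et al. with alpha = 2 - b and beta = b. *)
Definition hookterm (K i b N M m : int) : ratfun :=
  q ^ (2 * m * (K * m + i) - K * b * m) * qbinom (N + M) (N - K * m) -
  q ^ ((K * m - i) * (2 * m - b)) * qbinom (N + M) (N + i - K * m).

Definition hookpoly (K i b N M : int) : ratfun :=
  \sum_(m \in [set: int]%classic) hookterm K i b N M m.

Lemma finsupp_hookterm K i b N M : 0 < K -> finsupp (hookterm K i b N M).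
Proof.
move=> K0; apply: finsuppD; first exact/finsuppM/finsupp_qbinom.
have [B BP] := @finsupp_qbinom (N + M) (N + i) _ K0.
by exists B => j /BP ->; rewrite mulr0 oppr0.
Qed.

(** Here [c] is the power common to all terms and [e'] the exponent in the shifted family, so each
    recurrence below reduces to an identity of exponents. *)
Lemma qX_qbinom_pascal (e e' c a b : int) : 0 < a -> e + b = c + e' ->
  q ^ e * qbinom a b =
  q ^ e * qbinom (a - 1) (b - 1) + q ^ c * (q ^ e' * qbinom (a - 1) b).
Proof.
move=> a0 eE; rewrite qbinom_pascal // mulrDr; congr (_ + _).
by rewrite !mulrA -!expfzDr ?q_neq0 // eE.
Qed.

Lemma qX_qbinom_pascal_sym (e e' c a b : int) : 0 < a -> e + (a - b) = c + e' ->
  q ^ e * qbinom a b =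
  q ^ e * qbinom (a - 1) b + q ^ c * (q ^ e' * qbinom (a - 1) (b - 1)).
Proof.
move=> a0 eE; rewrite qbinom_pascal_sym // mulrDr; congr (_ + _).
by rewrite !mulrA -!expfzDr ?q_neq0 // eE.
Qed.

(** Raising [b] by 1 lowers the two exponents by [K m] and [K m - i], just what the Pascal factors
    [q^(N - K m)] and [q^(N + i - K m)] leave once [q^N] is taken out. *)
Lemma hookterm_recl (K i b N M m : int) : 0 < N + M ->
  hookterm K i b N M m =
  hookterm K i b (N - 1) M m + q ^ N * hookterm K i (b + 1) N (M - 1) m.
Proof.
move=> NM; rewrite /hookterm [X in _ = _ + X]mulrBr [RHS]addrACA -opprD.
congr (_ - _).
  rewrite (@qX_qbinom_pascal _ (2 * m * (K * m + i) - K * (b + 1) * m) N) //;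
    last by ring.
  by congr (_ * qbinom _ _ + _ * (_ * qbinom _ _)); lia.
rewrite (@qX_qbinom_pascal _ ((K * m - i) * (2 * m - (b + 1))) N) //; last by ring.
by congr (_ * qbinom _ _ + _ * (_ * qbinom _ _)); lia.
Qed.

Lemma hookterm_recr (K i b N M m : int) : 0 < N + M ->
  hookterm K i b N M m =
  hookterm K i b N (M - 1) m + q ^ M * hookterm K i (b - 1) (N - 1) M m.
Proof.
move=> NM; rewrite /hookterm [X in _ = _ + X]mulrBr [RHS]addrACA -opprD.
congr (_ - _).
  rewrite (@qX_qbinom_pascal_sym _ (2 * m * (K * m + i) - K * (b - 1) * m) M) //;
    last by ring.
  by congr (_ * qbinom _ _ + _ * (_ * qbinom _ _)); lia.
rewrite (@qX_qbinom_pascal_sym _ ((K * m - i) * (2 * m - (b - 1))) M) //;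
  last by ring.
by congr (_ * qbinom _ _ + _ * (_ * qbinom _ _)); lia.
Qed.

Lemma hookpoly_recl (K i b N M : int) : 0 < K -> 0 < N + M ->
  hookpoly K i b N M =
  hookpoly K i b (N - 1) M + q ^ N * hookpoly K i (b + 1) N (M - 1).
Proof.
move=> K0 NM; rewrite /hookpoly mulr_fsumr -sumZD; first last.
- exact/finsuppM/finsupp_hookterm.
- exact: finsupp_hookterm.
by apply: eq_fsbigr => m _; exact: hookterm_recl.
Qed.

Lemma hookpoly_recr (K i b N M : int) : 0 < K -> 0 < N + M ->
  hookpoly K i b N M =
  hookpoly K i b N (M - 1) + q ^ M * hookpoly K i (b - 1) (N - 1) M.
Proof.
move=> K0 NM; rewrite /hookpoly mulr_fsumr -sumZD; first last.
- exact/finsuppM/finsupp_hookterm.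
- exact: finsupp_hookterm.
by apply: eq_fsbigr => m _; exact: hookterm_recr.
Qed.

Lemma sumZ_reindex_cancel (f g : int -> ratfun) (h : int -> int) :
  finsupp f -> involutive h -> (forall m, g m = f (h m)) ->
  \sum_(m \in [set: int]%classic) (f m - g m) = 0.
Proof.
move=> [B fB] hK gE.
have [C gC] : finsupp g.
  (* If [g m] is nonzero then [|h m| <= B], and [m = h (h m)] is one of the finitely many values
     [h k], [h (- k)] with [k <= B]; the sum of their absolute values bounds [m]. *)
  exists (\sum_(k < B.+1) (`|h k%:Z| + `|h (- k%:Z)|))%N => m mC; rewrite gE.
  apply: fB; rewrite ltnNge; apply/negP => hB; move: mC; apply/negP; rewrite -leqNgt.
  rewrite (bigD1 (Ordinal (hB : (`|h m| < B.+1)%N))) //=.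
  have [h0|h0] := lerP 0 (h m).
    by rewrite gez0_abs // hK -addnA leq_addr.
  by rewrite ltz0_abs // opprK hK; lia.
rewrite sumZD; [|by exists B|by exists C => m /gC ->; rewrite oppr0].
have -> : \sum_(m \in [set: int]%classic) - g m =
    - \sum_(m \in [set: int]%classic) g m.
  by rewrite -mulN1r mulr_fsumr; apply: eq_fsbigr => m _; rewrite mulN1r.
apply/eqP; rewrite subr_eq0; apply/eqP.
rewrite (@reindex_fsbigT _ _ _ _ _ h f); last by exists h.
by apply: eq_fsbigr => m _; rewrite gE.
Qed.

(** On this edge, complementing the second bracket and reflecting [m] to [- m] turns the negative
    terms into the positive ones. *)
Lemma hookpoly_bot (K i N M : int) : 0 < K -> N - M = - i ->
  hookpoly K i 0 N M = 0.
Proof.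
move=> K0 NM; apply: (@sumZ_reindex_cancel _ _ (fun m => - m)).
- exact/finsuppM/finsupp_qbinom.
- exact: opprK.
move=> m; rewrite -[in LHS]qbinom_sym.
by congr (q ^ _ * qbinom _ _); [ring|lia].
Qed.

Lemma hookpoly_top (K i N M : int) : 0 < K -> N - M = K - i ->
  hookpoly K i 2 N M = 0.
Proof.
move=> K0 NM; apply: (@sumZ_reindex_cancel _ _ (fun m => 1 - m)).
- exact/finsuppM/finsupp_qbinom.
- by move=> m; lia.
move=> m; rewrite -[in LHS]qbinom_sym.
by congr (q ^ _ * qbinom _ _); [ring|lia].
Qed.

(** In either case [N < K - i] and [M < i], which puts every bracket out of range except the first
    one at [m = 0]; that one vanishes by the sign itself. *)
Lemma hookpoly_neg (K i b N M : int) : 0 < i < K -> - i <= N - M <= K - i ->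
  N < 0 \/ M < 0 -> hookpoly K i b N M = 0.
Proof.
move=> iK NM h; rewrite /hookpoly fsbig1 // => m _; rewrite /hookterm.
have [m0|m0] := lerP m (-1); last have [m1|m1] := lerP 1 m.
- by rewrite !qbinom_out ?mulr0 ?subr0 //; nia.
- by rewrite !qbinom_out ?mulr0 ?subr0 //; nia.
- have -> : m = 0 by lia.
  by rewrite !qbinom_out ?mulr0 ?subr0 //; lia.
Qed.

Lemma hookpoly00 (K i b : int) : 0 < i < K -> hookpoly K i b 0 0 = 1.
Proof.
move=> iK; rewrite /hookpoly (fsbigE [:: 0]) //=; last first.
  move=> m _; rewrite inE => m0; rewrite /hookterm.
  by rewrite !qbinom_out ?mulr0 ?subr0 //; nia.
rewrite big_cons big_nil in_setT addr0 /hookterm.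
rewrite (@qbinom_out _ (0 + i - K * 0)); last by lia.
rewrite [X in qbinom _ X](_ : _ = 0); last by lia.
rewrite [X in qbinom X](_ : _ = 0); last by lia.
rewrite [X in q ^ X](_ : _ = 0); last by lia.
by rewrite expr0z mul1r mulr0 subr0 qbinomn0.
Qed.

(* The interval for [N - M] is [beta - i <= N - M <= K - i - alpha]; one of the two
   Pascal rules stays inside it except where the polynomial vanishes. *)
Lemma nonneg_hookpoly (K i b N M : int) : 2 < K -> 0 < i < K -> 0 <= b <= 2 ->
  b - i <= N - M <= K - i - (2 - b) -> nonneg_coefs (hookpoly K i b N M).
Proof.
move=> K2 iK; have K0 : 0 < K by lia.
(* Induction on a bound for [N + M], which both recurrences lower by one. *)
have [k] : exists k : nat, N + M <= k%:Z by exists `|(N + M)%R|%N; lia.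
elim: k b N M => [|k IH] b N M NMk b02 NMb.
all: have [h|h] := boolP ((N < 0) || (M < 0));
  first by rewrite hookpoly_neg; [exact: nonneg_coefs0|lia|lia|lia].
  have [-> ->] : N = 0 /\ M = 0 by lia.
  by rewrite hookpoly00; [exact: nonneg_coefs1|].
have [NM0|NM0] := lerP (N + M) 0; first by apply: IH => //; lia.
have [/andP[b0 E]|h1] := boolP ((b == 0) && (N - M == - i)).
  by rewrite (eqP b0) hookpoly_bot ?(eqP E) //; exact: nonneg_coefs0.
have [/andP[b2 E]|h2] := boolP ((b == 2) && (N - M == K - i)).
  by rewrite (eqP b2) hookpoly_top ?(eqP E) //; exact: nonneg_coefs0.
(* [b = 2] cannot be raised, and for [b = 1] on the lower edge decreasing [N] would leave the
   interval. The other recurrence stays inside, on that edge thanks to [2 < K]. *)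
have [h3|h3] := boolP ((b == 2) || (b == 1) && (N - M == 1 - i)).
  rewrite hookpoly_recr //; apply: nonneg_coefsD; first by apply: IH; lia.
  by apply: nonneg_coefsM; [apply: nonneg_coefs_qX; lia|apply: IH; lia].
rewrite hookpoly_recl //; apply: nonneg_coefsD; first by apply: IH; lia.
by apply: nonneg_coefsM; [apply: nonneg_coefs_qX; lia|apply: IH; lia].
Qed.

(** * The q-Vandermonde sum and the doubling identity *)

Lemma qbinom_pascalS (n k : nat) :
  qbinom n.+1 k.+1 = qbinom n k + q ^+ k.+1 * qbinom n k.+1.
Proof.
rewrite qbinom_pascal // -exprnP.
by congr (qbinom _ _ + _ * qbinom _ _); lia.
Qed.

(** Induction on [m] by the Pascal rule on both sides. The truncated [m - j] is harmless:
    [qbinom m j] vanishes for [j > m]. *)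
Lemma qbinom_vandermonde (m n k : nat) :
  qbinom (m + n)%N k =
  \sum_(j < k.+1) q ^+ ((m - j) * (k - j)) * (qbinom m j * qbinom n (k - j)%N).
Proof.
elim: m k => [|m IH] k.
  rewrite big_ord_recl big1 => [|j _]; last first.
    by rewrite (@qbinom_out 0 _) ?mul0r ?mulr0 //; right.
  by rewrite addr0 !subn0 mul0n expr0 mul1r qbinomn0 // mul1r.
case: k => [|k].
  by rewrite big_ord1 subn0 muln0 expr0 !qbinomn0 // !mul1r.
rewrite addSn qbinom_pascalS !IH.
(* [A] and [B] are the two halves of the Pascal rule for [qbinom m.+1 j]; the match supplies the
   value 0 of the bracket with bottom -1. *)
pose A (j : nat) := q ^+ ((m.+1 - j) * (k.+1 - j)) *
  ((if j is j'.+1 then qbinom m j' else 0) * qbinom n (k.+1 - j)%N).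
pose B (j : nat) := q ^+ k.+1 * (q ^+ ((m - j) * (k.+1 - j)) *
  (qbinom m j * qbinom n (k.+1 - j)%N)).
have -> : \sum_(j < k.+2) q ^+ ((m.+1 - j) * (k.+1 - j)) *
    (qbinom m.+1 j * qbinom n (k.+1 - j)%N) = \sum_(j < k.+2) (A j + B j).
  apply: eq_bigr => -[j /= jk] _; rewrite /A /B.
  case: j jk => [|j] jk.
    by rewrite mul0r mulr0 add0r !subn0 !qbinomn0 // [RHS]mulrA -exprD mulSn.
  rewrite qbinom_pascalS mulrDl mulrDr !subSS; congr (_ + _).
  have [jm|jm] := leqP j.+1 m; last first.
    by rewrite (@qbinom_out m) ?(mul0r, mulr0) //; right.
  rewrite !mulrA -!exprD; congr (q ^+ _ * _ * _).
  by move: (subnK jm) (subnK (jk : (j <= k)%N)); nia.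
rewrite big_split /=; congr (_ + _); last by rewrite mulr_sumr.
have A0 : A 0%N = 0 by rewrite /A mul0r mulr0.
by rewrite [RHS]big_ord_recl /= A0 add0r.
Qed.

Lemma sum_ord_widen0 (V : nmodType) (n m : nat) (f : nat -> V) : (n <= m)%N ->
  (forall s, (n <= s)%N -> f s = 0) -> \sum_(s < n) f s = \sum_(s < m) f s.
Proof.
move=> nm f0; rewrite (big_ord_widen m f nm) [RHS](bigID (fun s : 'I_m => (s < n)%N)).
by rewrite /= [X in _ + X]big1 ?addr0 // => s; rewrite -leqNgt => /f0.
Qed.

Lemma sum_shift (V : zmodType) (N h : nat) (f : nat -> V) :
  (forall s, (s < h)%N -> f s = 0) -> (forall s, (N <= s)%N -> f s = 0) ->
  \sum_(s < N) f s = \sum_(p < N) f (p + h)%N.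
Proof.
move=> f1 f2; rewrite (@sum_ord_widen0 _ _ _ _ (leq_addr h N) f2) -(big_mkord xpredT).
rewrite (@big_cat_nat _ _ _ h) ?leq_addl //= big_nat_cond big1 ?add0r; last first.
  by move=> s /andP[/andP[_ /f1]].
by rewrite -{1}[h]add0n big_addn addnK big_mkord.
Qed.

(** The q-Vandermonde sum for [L + L] and bottom [L - a], read backwards with [u = L - a - j]. *)
Lemma qbinom_central (L a : nat) :
  qbinom (L + L)%N (L%:Z - a%:Z) =
  \sum_(u < L.+1) q ^+ (u * (u + a)) * (qbinom L u * qbinom L (u + a)%N).
Proof.
have [aL|aL] := leqP a L; last first.
  rewrite qbinom_out; last by lia.
  by rewrite big1 // => u _; rewrite (@qbinom_out L (u + a)%N) ?mulr0 //; lia.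
rewrite (_ : L%:Z - a%:Z = (L - a)%N); last by lia.
rewrite qbinom_vandermonde (reindex_inj rev_ord_inj) /=.
pose f u := q ^+ (u * (u + a)) * (qbinom L u * qbinom L (u + a)%N).
have f0 u : (L - a < u)%N -> f u = 0.
  by move=> h; rewrite /f (@qbinom_out L (u + a)%N) ?mulr0 //; lia.
rewrite -(@sum_ord_widen0 _ (L - a).+1 _ f) ?ltnS ?leq_subr //.
apply: eq_bigr => -[u /= uL] _; rewrite /f.
rewrite -[qbinom L (_ - _.+1)%N]qbinom_sym mulrC [qbinom _ _ * _]mulrC [RHS]mulrC.
by congr (qbinom _ _ * qbinom _ _ * q ^+ _); lia || nia.
Qed.

Lemma multinomial_field (F : fieldType) (l i w t m p r x y : F) :
  i != 0 -> w != 0 -> t != 0 -> m != 0 -> p != 0 -> r != 0 -> x != 0 -> y != 0 ->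
  l / (i * w) * (i / (t * m) * (m / (p * r))) =
  l / (x * y) * (x / (t * p) * (y / (r * w))).
Proof.
by move=> i0 w0 t0 m0 p0 r0 x0 y0; field; rewrite i0 w0 t0 m0 p0 r0 x0 y0.
Qed.

(** Both sides are the q-multinomial coefficient of [L] with parts [p], [r], [t] and the rest,
    chosen in two different orders. *)
Lemma qbinom_multinomial (L p r t : nat) :
  qbinom L (p + r + t)%N * (qbinom (p + r + t)%N t * qbinom (p + r)%N p) =
  qbinom L (p + t)%N * (qbinom (p + t)%N t * qbinom (L - (p + t))%N r).
Proof.
have [iL|iL] := leqP (p + r + t) L; last first.
  rewrite qbinom_out ?mul0r; last by lia.
  have [uL|uL] := leqP (p + t) L; last by rewrite qbinom_out ?mul0r //; lia.
  by rewrite (@qbinom_out (L - (p + t))%N) ?mulr0 //; lia.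
have [w ->] : exists w, L = (p + r + t + w)%N by exists (L - (p + r + t))%N; lia.
rewrite qbinomE [X in qbinom X t * qbinom _ p](_ : _ = (t + (p + r))%N%:Z); last by lia.
rewrite [X in _ = qbinom X _ * _](_ : _ = (p + t + (r + w))%N%:Z); last by lia.
rewrite [X in _ = _ * (qbinom X _ * _)](_ : _ = (t + p)%N%:Z); last by lia.
rewrite [X in _ = _ * (_ * qbinom X _)](_ : _ = (r + w)%N%:Z); last by lia.
rewrite !qbinomE (addnC t (p + r)) (addnC t p).
rewrite [X in _ = qfact X / _ * _](_ : _ = p + r + t + w)%N; last by lia.
by apply: multinomial_field; exact: qfact_neq0.
Qed.

(** With [A = D + 2 h], [M = 2 s + D] and [i = M + t] this is the positive expansion announced
    above, divided by [q^(D^2/2)] to keep exponents integral. The second Vandermonde sum splits [L]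
    as [u + (L - u)]; then [u = p + t] and [s = p + h]. *)
Lemma qbinom_doubling_nat (L D h : nat) :
  q ^+ (2 * h * (h + D)) * qbinom (L + L)%N (L%:Z - (D + 2 * h)%N%:Z) =
  \sum_(t < L.+1) \sum_(s < L.+1)
    q ^+ ((2 * s + D + t) * t + 2 * s * (s + D)) *
    (qbinom L (2 * s + D + t)%N * (qbinom (2 * s + D + t)%N t *
      qbinom (2 * s + D)%N (s%:Z - h%:Z))).
Proof.
set a := (D + 2 * h)%N; rewrite qbinom_central.
pose g t u := q ^+ (u * (u + a)) * (q ^+ ((u - t) * (u + a - t)) *
  (qbinom L u * (qbinom u t * qbinom (L - u)%N (u + a - t)%N))).
have -> : \sum_(u < L.+1) q ^+ (u * (u + a)) * (qbinom L u * qbinom L (u + a)%N) =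
    \sum_(t < L.+1) \sum_(u < L.+1) g t u.
  rewrite exchange_big /=; apply: eq_bigr => -[u /= uL] _.
  rewrite -[X in _ * (_ * qbinom X _)](_ : (u + (L - u))%N%:Z = L%:Z); last by lia.
  rewrite qbinom_vandermonde 2!mulr_sumr.
  pose G t := g t u.
  have G0 t : (u < t)%N -> G t = 0.
    by move=> ut; rewrite /G /g (@qbinom_out u) ?(mul0r, mulr0) //; right.
  transitivity (\sum_(t < (u + a).+1) G t).
    by apply: eq_bigr => t _; rewrite /G /g [qbinom L u * (_ * _)]mulrCA.
  by rewrite -(@sum_ord_widen0 _ u.+1 _ G) ?ltnS ?leq_addr //
    (@sum_ord_widen0 _ _ _ _ uL G0).
rewrite mulr_sumr; apply: eq_bigr => -[t /= _] _.
rewrite (@sum_shift _ _ t (g t)); first last.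
- by move=> u Lu; rewrite /g (@qbinom_out L) ?(mul0r, mulr0) //; right.
- by move=> u ut; rewrite /g (@qbinom_out u) ?(mul0r, mulr0) //; right.
rewrite [RHS](@sum_shift _ _ h (fun s =>
  q ^+ ((2 * s + D + t) * t + 2 * s * (s + D)) * (qbinom L (2 * s + D + t)%N *
  (qbinom (2 * s + D + t)%N t * qbinom (2 * s + D)%N (s%:Z - h%:Z))))); first last.
- by move=> s Ls; rewrite (@qbinom_out L) ?(mul0r, mulr0) //; right; lia.
- by move=> s sh; rewrite (@qbinom_out _ (s%:Z - h%:Z)) ?(mul0r, mulr0) //; left; lia.
rewrite mulr_sumr; apply: eq_bigr => -[p /= _] _; rewrite /g.
rewrite (_ : (p + h)%N%:Z - h%:Z = p); last by lia.
rewrite (_ : 2 * (p + h) + D = p + (p + a))%N; last by rewrite /a; lia.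
rewrite qbinom_multinomial !mulrA -!exprD.
by congr (q ^+ _ * qbinom _ _ * qbinom _ _ * qbinom _ _); rewrite ?/a; nia.
Qed.

(* The hypothesis on h says [|D + 2 h| >= D]; it lets the sum run over s >= 0. *)
Lemma qbinom_doubling (L D : nat) (h : int) : 0 <= h \/ h <= - D%:Z ->
  q ^ (2 * h * (h + D%:Z)) * qbinom (L + L)%N (L%:Z - (D%:Z + 2 * h)) =
  \sum_(t < L.+1) \sum_(s < L.+1)
    q ^+ ((2 * s + D + t) * t + 2 * s * (s + D)) *
    (qbinom L (2 * s + D + t)%N * (qbinom (2 * s + D + t)%N t *
      qbinom (2 * s + D)%N (s%:Z - h))).
Proof.
case=> hD.
  case: h hD => // h _; rewrite -qbinom_doubling_nat exprnP.
  by congr (q ^ _ * qbinom _ _); lia.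
(* The reflection [h] to [- D - h] keeps the exponent [2 h (h + D)] and changes the sign of
   [D + 2 h]; symmetry of the brackets absorbs this. *)
have [k hE] : exists k : nat, h = - D%:Z - k%:Z by exists `|(- D%:Z - h)%R|%N; lia.
transitivity (q ^+ (2 * k * (k + D)) *
    qbinom (L + L)%N (L%:Z - (D + 2 * k)%N%:Z)).
  rewrite -[in RHS]qbinom_sym exprnP.
  by congr (q ^ _ * qbinom _ _); rewrite hE; [rewrite !(PoszM, PoszD); ring|lia].
rewrite qbinom_doubling_nat; apply: eq_bigr => t _; apply: eq_bigr => s _.
by rewrite -[qbinom (2 * s + D)%N _]qbinom_sym; congr (_ * (_ * (_ * qbinom _ _))); lia.
Qed.

(** * Positivity of the alternating sums by induction on n *)

Lemma third_pow4S n : ((4 ^ n.+1 - 1) %/ 3 = (4 ^ n - 1) %/ 3 + 4 ^ n)%N.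
Proof. by have := expn_gt0 4 n; rewrite expnS; lia. Qed.

(* Top M and offset c are separate from n so that n = 0 with Delta odd, where
   M = 2 c + Delta is odd, is covered. *)
Definition gterm (v Delta n : nat) (M c j : int) : ratfun :=
  (-1) ^ j *
  (q ^ ((2 * v * ((4 ^ n - 1) %/ 3) + 1)%:Z * (j * (v%:Z * j + Delta%:Z))) *
    qbinom M (c - (2 ^ n * v)%N%:Z * j)).

Definition gsum (v Delta n : nat) (M c : int) : ratfun :=
  \sum_(j \in [set: int]%classic) gterm v Delta n M c j.

Lemma finsupp_gterm v Delta n M c : (0 < v)%N -> finsupp (gterm v Delta n M c).
Proof.
move=> v0; apply/finsuppM/finsuppM/finsupp_qbinom.
by rewrite ltz_nat muln_gt0 expn_gt0.
Qed.

Lemma signz_double (F : fieldType) (m : int) : (-1) ^ (2 * m) = 1 :> F.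
Proof. by rewrite -exprz_exp -exprnP sqrrN expr1n exp1rz. Qed.

Lemma signz_onem_double (F : fieldType) (m : int) : (-1) ^ (1 - 2 * m) = -1 :> F.
Proof.
by rewrite expfzDr ?oppr_eq0 ?oner_eq0 // -mulrN signz_double mulr1.
Qed.

(** Even and odd [j] give the positive and negative terms of a hook polynomial with [K = 2 v],
    [i = v + Delta], [b = 1] and [N - M = - Delta], which lies in the admissible interval. *)
Lemma nonneg_gsum0 (v Delta s : nat) : (2 <= v)%N -> (Delta < v)%N ->
  nonneg_coefs (gsum v Delta 0 (2 * s + 2 ^ 0 * Delta)%N s).
Proof.
move=> v2 Dv.
suff -> : gsum v Delta 0 (2 * s + 2 ^ 0 * Delta)%N s =
    hookpoly (2 * v%:Z) (v%:Z + Delta%:Z) 1 s (s%:Z + Delta%:Z).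
  by apply: nonneg_hookpoly; lia.
rewrite /gsum sumZ_even_odd; last by apply: finsupp_gterm; lia.
apply: eq_fsbigr => m _; rewrite /gterm /hookterm; congr (_ + _).
  rewrite signz_double mul1r.
  by congr (q ^ _ * qbinom _ _); [rewrite expn0 subnn div0n muln0; ring|lia|lia].
rewrite signz_onem_double mulN1r -qbinom_sym.
congr (- (q ^ _ * qbinom _ _)); [|lia|lia].
by rewrite expn0 subnn div0n muln0; ring.
Qed.

(** The doubling identity is applied to each term with [h = 2^n v j]; its coefficients are free of
    [j] and come out of the sum. *)
Lemma gsum_doubling (v Delta n s : nat) : (0 < v)%N -> (Delta < v)%N ->
  let D := (2 ^ n * Delta)%N in let L := (s + D)%N in
  gsum v Delta n.+1 (2 * s + 2 ^ n.+1 * Delta)%N s =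
  \sum_(t < L.+1) \sum_(r < L.+1)
    q ^+ ((2 * r + D + t) * t + 2 * r * (r + D)) *
    (qbinom L (2 * r + D + t)%N * qbinom (2 * r + D + t)%N t) *
    gsum v Delta n (2 * r + D)%N r.
Proof.
move=> v0 Dv D L.
pose w (t r : nat) := q ^+ ((2 * r + D + t) * t + 2 * r * (r + D)) *
    (qbinom L (2 * r + D + t)%N * qbinom (2 * r + D + t)%N t).
transitivity (\sum_(j \in [set: int]%classic) \sum_(t < L.+1) \sum_(r < L.+1)
    w t r * gterm v Delta n (2 * r + D)%N r j); last first.
  rewrite sumZ_sum => [|t]; last first.
    by apply: finsupp_sum => r; apply/finsuppM/finsupp_gterm.
  apply: eq_bigr => t _; rewrite sumZ_sum => [|r]; last exact/finsuppM/finsupp_gterm.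
  by apply: eq_bigr => r _; rewrite -mulr_fsumr.
apply: eq_fsbigr => j _.
set h : int := (2 ^ n * v)%N%:Z * j.
(* For [j < 0], [Delta < v] gives [v j + Delta < 0], hence [h <= - D]. *)
have hD : 0 <= h \/ h <= - D%:Z.
  have [j0|j0] := lerP 0 j; [left; exact: mulr_ge0|right].
  have -> : h = - D%:Z - (2 ^ n)%N%:Z * - (v%:Z * j + Delta%:Z).
    by rewrite /h /D !PoszM; ring.
  by rewrite gerBl mulr_ge0 //; nia.
set e := (2 * v * ((4 ^ n - 1) %/ 3) + 1)%:Z * (j * (v%:Z * j + Delta%:Z)).
have -> : gterm v Delta n.+1 (2 * s + 2 ^ n.+1 * Delta)%N s j =
    (-1) ^ j * (q ^ e * (q ^ (2 * h * (h + D%:Z)) *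
      qbinom (L + L)%N (L%:Z - (D%:Z + 2 * h)))).
  rewrite /gterm [q ^ e * _]mulrA -expfzDr ?q_neq0 //.
  congr (_ * (q ^ _ * qbinom _ _)).
  (* The increment [4^n] of [(4^n - 1) / 3] contributes [2 v 4^n j (v j + Delta)], which is
     [2 h (h + D)]. *)
  - rewrite third_pow4S /e /h /D (_ : 4 ^ n = 2 ^ n * 2 ^ n)%N; last first.
      by rewrite -expnMn.
    by rewrite !(PoszM, PoszD); ring.
  - by rewrite /L /D expnS; lia.
  - by rewrite /L /h /D expnS; lia.
rewrite qbinom_doubling // !mulr_sumr; apply: eq_bigr => t _.
rewrite !mulr_sumr; apply: eq_bigr => r _; rewrite /w /gterm -/e -/h.
rewrite [RHS]mulrCA; congr (_ * _); rewrite [RHS]mulrCA; congr (_ * _).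
by rewrite !mulrA.
Qed.

Lemma nonneg_gsum (v Delta n s : nat) : (2 <= v)%N -> (Delta < v)%N ->
  nonneg_coefs (gsum v Delta n (2 * s + 2 ^ n * Delta)%N s).
Proof.
move=> v2 Dv; elim: n s => [|n IH] s; first exact: nonneg_gsum0.
rewrite gsum_doubling //; last by lia.
apply: nonneg_coefs_sum => t; apply: nonneg_coefs_sum => r.
apply: nonneg_coefsM; last exact: IH.
apply: nonneg_coefsM; first by rewrite exprnP; exact: nonneg_coefs_qX.
by apply: nonneg_coefsM; exact: nonneg_coefs_qbinom.
Qed.

Theorem theorem5p6 (R : realType) (v n Delta L : nat)
    (hv : (2 <= v)%N) (hn : (1 <= n)%N) (hDelta : (Delta < v)%N) :
  nonneg_coefs
    (G (L%:Z - (Delta * 2 ^ (n - 1))%:Z) (L%:Z + (Delta * 2 ^ (n - 1))%:Z)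
       ((v%:R + Delta%:R) * (2 * ((2 ^+ n - 2 ^- n) / 3) + 1 / (2 ^+ n * v%:R)) : R)
       ((v%:R - Delta%:R) * (2 * ((2 ^+ n - 2 ^- n) / 3) + 1 / (2 ^+ n * v%:R)) : R)
       (2 ^ n * v)%N).
Proof.
have -> : G (L%:Z - (Delta * 2 ^ (n - 1))%:Z) (L%:Z + (Delta * 2 ^ (n - 1))%:Z)
    ((v%:R + Delta%:R) * (2 * ((2 ^+ n - 2 ^- n) / 3) + 1 / (2 ^+ n * v%:R)) : R)
    ((v%:R - Delta%:R) * (2 * ((2 ^+ n - 2 ^- n) / 3) + 1 / (2 ^+ n * v%:R)) : R)
    (2 ^ n * v)%N =
    gsum v Delta n (L + L)%N (L%:Z - (Delta * 2 ^ (n - 1))%:Z).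
  apply: eq_fsbigr => j _; rewrite /Gterm /gterm.
  (* The exponent is an integer, so the floor returns it exactly. *)
  have [e -> <-] := @Gexp_int R v n Delta j hv hDelta.
  rewrite pmulrn intrKfloor mulrA; congr (_ * qbinom _ _); lia.
have nE : (2 ^ n = 2 * 2 ^ (n - 1))%N by rewrite -expnS subn1 prednK.
have [sL|sL] := leqP (Delta * 2 ^ (n - 1)) L.
  rewrite (_ : L%:Z - _ = (L - Delta * 2 ^ (n - 1))%N); last by lia.
  rewrite (_ : L + L = 2 * (L - Delta * 2 ^ (n - 1)) + 2 ^ n * Delta)%N;
    last by rewrite nE; nia.
  exact: nonneg_gsum.
(* When [L < Delta 2^(n-1)] every term vanishes: the bottom is negative for [j >= 0], and exceeds
   [2 L] for [j < 0] because [v j + Delta < 0]. *)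
rewrite /gsum fsbig1; first exact: nonneg_coefs0.
move=> j _; rewrite /gterm qbinom_out ?mulr0 //; rewrite nE.
move: (2 ^ (n - 1))%N sL => P sL.
have [j0|j0] := lerP 0 j; [left|right].
  have : 0 <= (2 * P * v)%N%:Z * j by exact: mulr_ge0.
  by lia.
have e0 : 0 <= - (2 * (v%:Z * j + Delta%:Z)) by nia.
have : 0 <= P%:Z * - (2 * (v%:Z * j + Delta%:Z)) by exact: mulr_ge0.
by lia.
Qed.
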